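(* Fix $\kappa=0$. Let $\bar X_1,\bar X_3\in\mathbb{R}$ satisfy $\bar X_1=\tfrac14\bar X_3^2>0$. Then the sets $$\mathcal{W}_s(\bar X_3)=\{(A,B)\in\mathcal{D}:X_1(A,B)=\bar X_1,\ X_3(A,B)=\bar X_3,\ X_2(A,B)=0,\ \langle A,B\rangle<0\}$$ and $$\mathcal{W}_u(\bar X_3)=\{(A,B)\in\mathcal{D}:X_1(A,B)=\bar X_1,\ X_3(A,B)=\bar X_3,\ X_2(A,B)=0,\ \langle A,B\rangle>0\}$$ are nonempty and invariant under the flow of $$\ddot A(t)=\lambda(t)\,\mathrm{cof}\,A(t)\tag{E}$$ in $C^0(\mathbb{R},\mathrm{SL}(2,\mathbb{R}))\cap C^2(\mathbb{R},\mathbb{M}^2)$. Let $0<\mu<\tfrac12|\bar X_3|$. If $A\in C^0(\mathbb{R},\mathrm{SL}(2,\mathbb{R}))\cap C^2(\mathbb{R},\mathbb{M}^2)$ is a solution of (E) with initial data $(A(0),\dot A(0))=(A_0,B_0)\in\mathcal{W}_s(\bar X_3)$, then there exist a time $T>0$ and a phase $\theta_+$ such that $$\left|\left(\tfrac{d}{dt}\right)^j\left[A(t)-U\left(\tfrac12\bar X_3t+\theta_+\right)\right]\right|<e^{-\mu t},\quad j=0,1,\quad t>T.$$ If $(A_0,B_0)\in\mathcal{W}_u(\bar X_3)$, then there exist a time $T>0$ and a phase $\theta_-$ such that $$\left|\left(\tfrac{d}{dt}\right)^j\left[A(t)-U\left(\tfrac12\bar X_3t+\theta_-\right)\right]\right|<e^{\mu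 t},\quad j=0,1,\quad t<-T.$$
   Context: $\mathbb{M}^2$ is the space of real $2\times2$ matrices with inner product $\langle A,B\rangle=\mathrm{tr}(A^\top B)$ and norm $|A|=\langle A,A\rangle^{1/2}$. $\mathrm{SL}(2,\mathbb{R})=\{A:\det A=1\}$. $Z=\begin{bmatrix}0&-1\\1&0\end{bmatrix}$, $U(\theta)=\cos\theta\,I+\sin\theta\,Z$, and $\mathrm{cof}\,A=ZAZ^\top$ is the cofactor matrix. $\mathcal{D}=\{(A,B)\in\mathbb{M}^2\times\mathbb{M}^2:\det A=1,\ \langle B,\mathrm{cof}\,A\rangle=0\}$ is the tangent bundle of $\mathrm{SL}(2,\mathbb{R})$. With $\kappa=0$, $$X_1(A,B)=\tfrac12|B|^2,\quad X_2(A,B)=\tfrac12\langle ZA-AZ,B\rangle,\quad X_3(A,B)=\tfrac12\langle ZA+AZ,B\rangle.$$ A solution of (E) means that the equation holds for some $\lambda\in C^0(\mathbb{R},\mathbb{R})$ (necessarily $\lambda(t)=-2\det\dot A(t)/|A(t)|^2$); for each initial datum in $\mathcal{D}$ there is a unique global $\mathrm{SL}(2,\mathbb{R})$-valued solution. Invariance of a set under the flow means that if $(A(0),\dot A(0))$ is in the set then so is $(A(t),\dot A(t))$ for all $t\in\mathbb{R}$. *)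

(* Defs.v *)
From HB Require Import structures.
From mathcomp Require Import all_boot all_order all_algebra.
From mathcomp Require Import all_classical all_reals all_analysis.

Set Implicit Arguments.
Unset Strict Implicit.
Unset Printing Implicit Defensive.

Import Order.TTheory GRing.Theory Num.Theory.
Import numFieldNormedType.Exports.

Local Open Scope ring_scope.
Local Open Scope classical_set_scope.

Section Matrices.
Variable R : realType.
Implicit Types (A B : 'M[R]_2) (theta : R).

Definition mxdot A B : R := \tr (A^T *m B).

(* The library norm `|A| on matrices is the max norm; the estimates are stated
   with the Euclidean (Frobenius) norm, which induces the same topology. *)
Definition mxnorm A : R := Num.sqrt (mxdot A A).

Definition Z : 'M[R]_2 :=
  \matrix_(i < 2, j < 2) nth 0 (nth [::] [:: [:: 0; -1]; [:: 1; 0]] i) j.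

Definition U theta : 'M[R]_2 := cos theta *: 1%:M + sin theta *: Z.

Definition cof A : 'M[R]_2 := Z *m A *m Z^T.

Definition SL2 : set 'M[R]_2 := [set A | \det A = 1].

Definition TSL2 : set ('M[R]_2 * 'M[R]_2) :=
  [set AB | \det AB.1 = 1 /\ mxdot AB.2 (cof AB.1) = 0].

(* The constants of motion X1, X2, X3 in the case kappa = 0. *)
Definition X1 A B : R := 2^-1 * mxnorm B ^+ 2.
Definition X2 A B : R := 2^-1 * mxdot (Z *m A - A *m Z) B.
Definition X3 A B : R := 2^-1 * mxdot (Z *m A + A *m Z) B.

Definition Ws (x1 x3 : R) : set ('M[R]_2 * 'M[R]_2) :=
  [set AB | TSL2 AB /\
    [/\ X1 AB.1 AB.2 = x1, X3 AB.1 AB.2 = x3, X2 AB.1 AB.2 = 0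
      & mxdot AB.1 AB.2 < 0]].

Definition Wu (x1 x3 : R) : set ('M[R]_2 * 'M[R]_2) :=
  [set AB | TSL2 AB /\
    [/\ X1 AB.1 AB.2 = x1, X3 AB.1 AB.2 = x3, X2 AB.1 AB.2 = 0
      & 0 < mxdot AB.1 AB.2]].

End Matrices.

Section Flow.
Variable R : realType.
Implicit Types A : R -> 'M[R]_2.

Definition class_C2 A : Prop :=
  [/\ forall t, derivable A t 1,
      forall t, derivable A^`() t 1
    & continuous A^`(2)].

Definition solution A : Prop :=
  [/\ continuous A, forall t, SL2 (A t), class_C2 A
    & exists2 lambda : R -> R, continuous lambda &
        forall t, A^`(2) t = lambda t *: cof (A t)].

Definition invariant_flow (W : set ('M[R]_2 * 'M[R]_2)) : Prop :=
  forall A, solution A -> W (A 0, A^`() 0) -> forall t, W (A t, A^`() t).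

End Flow.

(* Main.v *)
Require Import Defs.
From HB Require Import structures.
From mathcomp Require Import all_boot all_order all_algebra.
From mathcomp Require Import all_classical all_reals all_analysis.
From mathcomp Require Import ring lra.

(** In the orthogonal basis I, Z, K = diag(1, -1), L = antidiag(1, 1), write
    A = p I + q Z + r K + s L and put w = p + i q, z = r + i s. Then
    det A = |w|^2 - |z|^2, the cofactor map is (w, z) |-> (w, -z), and the
    equation becomes w'' = lambda w, z'' = - lambda z. Hence
    X1 = |w'|^2 + |z'|^2, X3 = 2 Im(conj(w) w') and X2 = 2 Im(conj(z) z') are
    constants of motion (lemma [solution_null_motion]).

    Put c = x3 / 2. On the level X1 = c^2, X3 = 2 c, X2 = 0, the function
    n = |z|^2 satisfies the closed first-order relation
      n'^2 (1 + 2 n) = 4 c^2 n^2                  (lemma [orbit_radial]),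
    and the inner product of A and A' is 2 n'. This relation gives
    |n'| <= 2 |c| n, so n vanishes identically as soon as it vanishes once.
    Therefore n' has no zero if n' is nonzero at time 0, and its sign is
    constant: this is the invariance of the two sets (lemma [radial_deriv_lt0]).

    If n' < 0, then n decreases to 0, and once n is small the relation forces
    n' <= - 2 k n for any prescribed k < |c|; so n = O(exp(- 2 k t)) (lemma
    [radial_decay]). The rotating vector v = w exp(- i c t) satisfies
    |v'|^2 <= 2 c^2 n^2, so |v'| is bounded by a multiple of - n', and v
    converges with an error O(n) to a limit, of modulus 1 because
    |v|^2 = 1 + n. That limit is exp(i theta) (lemma [orbit_phase]). The
    squared distances of A to U(c t + theta), and of their derivatives, are then
    O(n), which is below exp(- 2 mu t) for large t when mu < k (lemma
    [orbit_asymptotics]). The case n' > 0 follows by reversing time. *)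


Set Implicit Arguments.
Unset Strict Implicit.
Unset Printing Implicit Defensive.

Import Order.TTheory GRing.Theory Num.Theory.
Import numFieldNormedType.Exports.

Local Open Scope ring_scope.
Local Open Scope classical_set_scope.

(** * Differentiation rules and consequences of the mean value theorem *)

Lemma is_derive1_continuous {R : realType} (f df : R -> R) :
  (forall t, is_derive t (1 : R) f (df t)) -> continuous f.
Proof.
move=> fD t; apply/differentiable_continuous/derivable1_diffP.
by case: (fD t).
Qed.

(** The differentiation rules for explicit abstractions [fun x => _], instead of
    the ring operations on functions. *)
Section DeriveRules.
Context {R : realType} {f g : R -> R} {t df dg : R}.
Hypotheses (fD : is_derive t (1 : R) f df) (gD : is_derive t (1 : R) g dg).

Lemma is_derive1_add : is_derive t (1 : R) (fun x => f x + g x) (df + dg).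
Proof. exact: (is_deriveD fD gD). Qed.

Lemma is_derive1_sub : is_derive t (1 : R) (fun x => f x - g x) (df - dg).
Proof. exact: (is_deriveB fD gD). Qed.

Lemma is_derive1_mul :
  is_derive t (1 : R) (fun x => f x * g x) (df * g t + f t * dg).
Proof.
apply: (@is_derive_eq _ _ _ (f * g)).
by rewrite addrC /GRing.scale/= [g t * _]mulrC.
Qed.

Lemma is_derive1_sqr :
  is_derive t (1 : R) (fun x => f x ^+ 2) (2 * (f t * df)).
Proof.
apply: (@is_derive_eq _ _ _ (f ^+ 2)).
by rewrite /GRing.scale/= expr1 -mulr_natl mulrA.
Qed.

Lemma is_derive1_scale (k : R) :
  is_derive t (1 : R) (fun x => k * f x) (k * df).
Proof. exact: (is_deriveZ k fD). Qed.

End DeriveRules.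

Lemma is_derive_cos_lin {R : realType} (k a t : R) :
  is_derive t (1 : R) (fun x => cos (k * x + a)) (- (k * sin (k * t + a))).
Proof.
apply: (@is_derive_eq _ _ _ (cos \o (fun x => k * x + a))).
by rewrite addr0 [_%:A]mulr1 mulNr mulrC.
Qed.

Lemma is_derive_sin_lin {R : realType} (k a t : R) :
  is_derive t (1 : R) (fun x => sin (k * x + a)) (k * cos (k * t + a)).
Proof.
apply: (@is_derive_eq _ _ _ (sin \o (fun x => k * x + a))).
by rewrite addr0 [_%:A]mulr1 mulrC.
Qed.

Lemma nondecreasing_after {R : realType} (f df : R -> R) (a : R) :
  (forall t, is_derive t (1 : R) f (df t)) -> (forall t, a <= t -> 0 <= df t) ->
  forall x y, a <= x -> x <= y -> f x <= f y.
Proof.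
move=> fD df0 x y ax xy.
have [|z + E] := @MVT_segment R f df x y xy (fun t _ => fD t).
  by apply: continuous_subspaceT; exact: (is_derive1_continuous fD).
rewrite in_itv/= => /andP[xz _].
by rewrite -subr_ge0 E mulr_ge0 ?subr_ge0// df0// (le_trans ax).
Qed.

Lemma nonincreasing_after {R : realType} (f df : R -> R) (a : R) :
  (forall t, is_derive t (1 : R) f (df t)) -> (forall t, a <= t -> df t <= 0) ->
  forall x y, a <= x -> x <= y -> f y <= f x.
Proof.
move=> fD df0 x y ax xy; rewrite -lerN2.
apply: (@nondecreasing_after R (- f) (fun t => - df t) a) => // t.
by move=> /df0; rewrite oppr_ge0.
Qed.

Lemma is_derive_mul_expR {R : realType} (f df : R -> R) (k t : R) :
  is_derive t (1 : R) f (df t) ->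
  is_derive t (1 : R) (fun x => f x * expR (k * x))
    ((df t + k * f t) * expR (k * t)).
Proof.
move=> fD.
apply: (@is_derive_eq _ _ _ (f * (expR \o ( *%R k)))).
by rewrite /GRing.scale/=; ring.
Qed.

(** Gronwall's inequality, in differential form. *)
Lemma exp_decay_after {R : realType} (f df : R -> R) (k a : R) :
  (forall t, is_derive t (1 : R) f (df t)) ->
  (forall t, a <= t -> df t <= - k * f t) ->
  forall t, a <= t -> f t <= f a * expR (k * a) * expR (- k * t).
Proof.
move=> fD dfle t at_.
have := @nonincreasing_after R _ _ a
  (fun x => is_derive_mul_expR k (fD x)) _ a t (lexx _) at_.
move=> H; rewrite mulNr expRN ler_pdivlMr ?expR_gt0//; apply: H => x ax.
by rewrite mulr_le0_ge0 ?expR_ge0//; have := dfle x ax; lra.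
Qed.

Lemma expR_eventually_lt {R : realType} (K k mu : R) :
  0 <= K -> mu < k -> exists2 T, 0 < T &
  forall t, T < t -> K * expR (- k * t) < expR (- mu * t).
Proof.
move=> K0 muk; exists ((K + 1) / (k - mu)).
  by rewrite divr_gt0 ?subr_gt0//; lra.
move=> t; rewrite ltr_pdivrMr ?subr_gt0// => Kt.
have -> : - mu * t = (k - mu) * t + - k * t by ring.
rewrite expRD ltr_pM2r ?expR_gt0//.
by have := expR_ge1Dx ((k - mu) * t); nra.
Qed.

(** If |f'| <= - g' with g nonnegative, then f - g is nondecreasing, f + g is
    nonincreasing, and the number l = sup (f - g) separates them. When g tends
    to 0, this is the convergence of f to l with error at most g. *)
Lemma limit_of_dominated {R : realType} (f df g dg : R -> R) :
  (forall t, is_derive t (1 : R) f (df t)) ->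
  (forall t, is_derive t (1 : R) g (dg t)) ->
  (forall t, 0 <= t -> `|df t| <= - dg t) -> (forall t, 0 <= g t) ->
  exists l, forall t, 0 <= t -> `|f t - l| <= g t.
Proof.
move=> fD gD dom g0.
have up x y : 0 <= x -> x <= y -> f x - g x <= f y - g y.
  apply: (@nondecreasing_after R (f - g) (fun t => df t - dg t) 0) => t.
  by move=> /dom; rewrite ler_norml => /andP[]; lra.
have dn x y : 0 <= x -> x <= y -> f y + g y <= f x + g x.
  apply: (@nonincreasing_after R (f + g) (fun t => df t + dg t) 0) => t.
  by move=> /dom; rewrite ler_norml => /andP[]; lra.
have key x y : 0 <= x -> 0 <= y -> f x - g x <= f y + g y.
  move=> x0 y0; case: (leP x y) => [xy|/ltW yx].
    by have := up x y x0 xy; have := g0 y; lra.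
  by have := dn y x y0 yx; have := g0 x; lra.
pose S := [set f x - g x | x in [set x : R | 0 <= x]].
have S0 : S (f 0 - g 0) by exists 0 => //=.
have ubS t : 0 <= t -> ubound S (f t + g t).
  by move=> t0 _ [x /= x0 <-]; apply: key.
exists (sup S) => t t0.
have h1 : f t - g t <= sup S.
  apply: sup_upper_bound; last by exists t.
  by split; [exists (f 0 - g 0)|exists (f 0 + g 0); apply: ubS].
have h2 : sup S <= f t + g t by apply: ge_sup; [exists (f 0 - g 0)|apply: ubS].
by rewrite ler_norml; apply/andP; split; lra.
Qed.

Lemma unit_circle_angle {R : realType} (a b : R) :
  a ^+ 2 + b ^+ 2 = 1 -> exists theta, cos theta = a /\ sin theta = b.
Proof.
move=> ab.
have a1 : -1 <= a <= 1 by apply/andP; split; nra.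
have ca : cos (acos a) = a by apply: acosK; rewrite in_itv.
have sa : sin (acos a) = `|b|.
  by rewrite sin_acos// -sqrtr_sqr; congr Num.sqrt; lra.
case: (leP 0 b) => b0; [exists (acos a)|exists (- acos a)].
  by rewrite ca sa ger0_norm.
by rewrite cosN sinN ca sa ltr0_norm// opprK.
Qed.

(** * The radial equation *)

(** The nonnegative function n, with continuous derivative m, satisfies
    n'^2 (1 + 2 n) = 4 c^2 n^2. *)
Record radial {R : realType} (c : R) (n m : R -> R) : Prop := {
  radial_derive : forall t, is_derive t (1 : R) n (m t);
  radial_cont : continuous m;
  radial_ge0 : forall t, 0 <= n t;
  radial_eq : forall t, m t ^+ 2 * (1 + 2 * n t) = 4 * c ^+ 2 * n t ^+ 2 }.

Section Radial.
Context {R : realType} {c : R} {n m : R -> R} (H : radial c n m).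

Lemma radial_le t : `|m t| <= 2 * `|c| * n t.
Proof.
have n0 := radial_ge0 H t; have E := radial_eq H t.
rewrite -(@ler_pXn2r _ 2)// ?nnegrE ?mulr_ge0//.
rewrite !exprMn !real_normK ?num_real//.
by have := sqr_ge0 (m t); nra.
Qed.

(** Uniqueness of the zero solution: n exp(- 2 |c| t) is nonincreasing and
    n exp(2 |c| t) is nondecreasing. *)
Lemma radial_zero t0 : n t0 = 0 -> forall t, n t = 0.
Proof.
move=> z0 t; apply/eqP; rewrite eq_le (radial_ge0 H t) andbT.
have le x : - (2 * `|c| * n x) <= m x <= 2 * `|c| * n x.
  by rewrite -ler_norml radial_le.
have D k x := is_derive_mul_expR k (radial_derive H x).
case: (leP t0 t) => [tt|/ltW tt].
  have := @nonincreasing_after R _ _ t0 (D (- (2 * `|c|))) _ _ _ (lexx _) tt.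
  rewrite z0 mul0r pmulr_lle0 ?expR_gt0//; apply=> x _.
  by rewrite mulr_le0_ge0 ?expR_ge0//; have /andP[] := le x; lra.
have := @nondecreasing_after R _ _ t (D (2 * `|c|)) _ _ _ (lexx _) tt.
rewrite z0 mul0r pmulr_lle0 ?expR_gt0//; apply=> x _.
by rewrite mulr_ge0 ?expR_ge0//; have /andP[] := le x; lra.
Qed.

Lemma radial_deriv_zero t0 : m t0 = 0 -> c != 0 -> n t0 = 0.
Proof.
move=> m0 c0; have := radial_eq H t0; rewrite m0 expr0n/= mul0r => /esym/eqP.
have c4 : 4 * c ^+ 2 != 0 by rewrite mulf_neq0 ?expf_neq0// pnatr_eq0.
by rewrite mulf_eq0 (negbTE c4)/= expf_eq0/= => /eqP.
Qed.

(** The case c = 0 needs a separate argument, since then n' vanishes without n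
    having to. *)
Lemma radial_deriv_neq0 : m 0 != 0 -> forall t, m t != 0.
Proof.
move=> m0 t; apply: contra_neq m0 => mt.
have [c0|c0] := eqVneq c 0.
  have := radial_le 0; rewrite c0 normr0 mulr0 mul0r normr_le0.
  by move=> /eqP.
have := radial_le 0; rewrite (radial_zero (radial_deriv_zero mt c0)) mulr0.
by rewrite normr_le0 => /eqP.
Qed.

Lemma radial_deriv_lt0 : m 0 < 0 -> forall t, m t < 0.
Proof.
move=> m0 t; rewrite ltNge; apply/negP => mt.
have nz := radial_deriv_neq0 (ltr0_neq0 m0).
have cm a b : {within `[a, b], continuous m}.
  by apply: continuous_subspaceT; exact: (radial_cont H).
have [t0|/ltW t0] := leP 0 t.
- have [|x _ mx] := @IVT R m 0 t 0 t0 (cm _ _).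
    by rewrite ge_min le_max mt (ltW m0) orbT.
  by have := nz x; rewrite mx eqxx.
- have [|x _ mx] := @IVT R m t 0 0 t0 (cm _ _).
    by rewrite ge_min le_max mt (ltW m0) orbT.
  by have := nz x; rewrite mx eqxx.
Qed.

Hypothesis m0 : forall t, m t < 0.

Lemma radial_gt0 t : 0 < n t.
Proof.
rewrite lt_neqAle (radial_ge0 H) andbT eq_sym; apply/eqP => nt.
by have := radial_le t; rewrite nt mulr0 normr_le0 lt_eqF.
Qed.

(** As n decreases, a rate k admissible for the value n a remains admissible at
    all later times. *)
Lemma radial_rate a k : 0 <= k -> k ^+ 2 * (1 + 2 * n a) <= c ^+ 2 ->
  forall t, a <= t -> m t <= - (2 * k) * n t.
Proof.
move=> k0 ka t at_.
have nta : n t <= n a.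
  apply: (@nonincreasing_after R n m a (radial_derive H)) => // x _.
  exact/ltW.
have E := radial_eq H t; have nt := radial_ge0 H t; have mt := m0 t.
rewrite mulNr lerNr -(@ler_pXn2r _ 2)// ?nnegrE ?mulr_ge0//; last by lra.
have D : 0 < 1 + 2 * n t by lra.
rewrite -(ler_pM2r D) sqrrN E !exprMn.
have kt : k ^+ 2 * (1 + 2 * n t) <= c ^+ 2.
  by apply: le_trans ka; rewrite ler_wpM2l ?sqr_ge0//; lra.
have := ler_wpM2r (sqr_ge0 (n t)) kt; lra.
Qed.

(** The decay rate that the initial value already guarantees. *)
Lemma radial_rate0 t : 0 <= t ->
  m t <= - (2 * (`|c| / (1 + 2 * n 0))) * n t.
Proof.
have n0 := radial_gt0 0; have D : 0 < 1 + 2 * n 0 by lra.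
apply: radial_rate; first by rewrite divr_ge0// ltW.
rewrite expr_div_n real_normK ?num_real// mulrAC ler_pdivrMr ?exprn_gt0//.
by rewrite ler_wpM2l ?sqr_ge0//; nra.
Qed.

(** n tends to 0 at infinity. *)
Lemma radial_small : c != 0 ->
  forall e, 0 < e -> exists2 T, 0 < T & forall t, T < t -> n t < e.
Proof.
move=> c0 e e0; have n0 := radial_gt0 0.
set k := `|c| / (1 + 2 * n 0).
have k0 : 0 < k by rewrite divr_gt0 ?normr_gt0//; lra.
have dec := exp_decay_after (radial_derive H) radial_rate0.
have ne0 : 0 <= n 0 / e by rewrite divr_ge0 ?ltW.
have k20 : 0 < 2 * k by rewrite mulr_gt0.
have [T T0 HT] := expR_eventually_lt ne0 k20.
exists T => // t Tt; have := dec t (ltW (lt_trans T0 Tt)).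
rewrite mulr0 expR0 mulr1 => /le_lt_trans; apply.
by have := HT t Tt; rewrite oppr0 mul0r expR0 mulrAC ltr_pdivrMr// mul1r.
Qed.

Lemma radial_decay k : 0 < k -> k < `|c| ->
  exists K T, [/\ 0 < K, 0 < T &
    forall t, T < t -> n t <= K * expR (- (2 * k) * t)].
Proof.
move=> k0 kc.
have c0 : c != 0 by rewrite -normr_gt0 (lt_trans k0).
have k2 : k ^+ 2 < c ^+ 2.
  by rewrite -(real_normK (num_real c)) ltr_pXn2r// nnegrE ltW.
(* the value of e for which k^2 (1 + 2 e) = c^2 *)
pose e := (c ^+ 2 - k ^+ 2) / (2 * k ^+ 2).
have kk : 0 < 2 * k ^+ 2 by rewrite mulr_gt0 ?exprn_gt0.
have e0 : 0 < e by rewrite divr_gt0 ?subr_gt0.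
have [T T0 HT] := radial_small c0 e0.
have nT : k ^+ 2 * (1 + 2 * n (T + 1)) <= c ^+ 2.
  have := HT (T + 1); rewrite ltrDl ltr01 => /(_ isT).
  by rewrite ltr_pdivlMr//; lra.
exists (n (T + 1) * expR (2 * k * (T + 1))), (T + 1); split.
- by rewrite mulr_gt0 ?expR_gt0 ?radial_gt0.
- by lra.
- move=> t /ltW Tt.
  exact: (exp_decay_after (radial_derive H) (radial_rate (ltW k0) nT)).
Qed.

End Radial.

Lemma is_derive1_opp_arg {R : realType} (f df : R -> R) (t : R) :
  (forall t, is_derive t (1 : R) f (df t)) ->
  is_derive t (1 : R) (fun x => f (- x)) (- df (- t)).
Proof.
move=> fD; apply: (@is_derive_eq _ _ _ (f \o -%R)).
by rewrite mulrN1.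
Qed.

Lemma radial_rev {R : realType} (c : R) (n m : R -> R) : radial c n m ->
  radial c (fun t => n (- t)) (fun t => - m (- t)).
Proof.
case=> nD mc n0 E; split=> [t|t|t|t]; rewrite ?n0 ?sqrrN ?E//.
  exact: is_derive1_opp_arg.
apply: cvgN; apply: (@continuous_comp _ _ _ -%R m); last exact: mc.
exact: opp_continuous.
Qed.

Lemma radial_deriv_gt0 {R : realType} (c : R) (n m : R -> R) :
  radial c n m -> 0 < m 0 -> forall t, 0 < m t.
Proof.
move=> H m0 t; have := radial_deriv_lt0 (radial_rev H) _ (- t).
by rewrite oppr0 oppr_lt0 opprK oppr_lt0; apply.
Qed.

(** * Null orbits *)

(** The coordinates p, q, r, s of a curve in SL(2, R) along I, Z, K, L, and
    their derivatives, on the level X1 = c^2, X3 = 2 c, X2 = 0. The second-order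
    equation enters only through these conservation laws. *)
Record null_orbit {R : realType} (c : R)
    (p q r s p' q' r' s' : R -> R) : Prop := {
  orbit_p : forall t, is_derive t (1 : R) p (p' t);
  orbit_q : forall t, is_derive t (1 : R) q (q' t);
  orbit_r : forall t, is_derive t (1 : R) r (r' t);
  orbit_s : forall t, is_derive t (1 : R) s (s' t);
  orbit_r' : continuous r';
  orbit_s' : continuous s';
  orbit_det : forall t, p t ^+ 2 + q t ^+ 2 = 1 + (r t ^+ 2 + s t ^+ 2);
  orbit_tan : forall t, p t * p' t + q t * q' t = r t * r' t + s t * s' t;
  orbit_X1 : forall t, p' t ^+ 2 + q' t ^+ 2 + (r' t ^+ 2 + s' t ^+ 2) = c ^+ 2;
  orbit_X3 : forall t, p t * q' t - q t * p' t = c;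
  orbit_X2 : forall t, r t * s' t - s t * r' t = 0 }.

(** Time reversal changes the sign of c. *)
Lemma null_orbit_rev {R : realType} (c : R) (p q r s p' q' r' s' : R -> R) :
  null_orbit c p q r s p' q' r' s' ->
  null_orbit (- c) (fun t => p (- t)) (fun t => q (- t)) (fun t => r (- t))
    (fun t => s (- t)) (fun t => - p' (- t)) (fun t => - q' (- t))
    (fun t => - r' (- t)) (fun t => - s' (- t)).
Proof.
case=> pD qD rD sD r'c s'c det tan X1 X3 X2.
have opc (f : R -> R) : continuous f -> continuous (fun t => - f (- t)).
  move=> fc t; apply: cvgN; apply: (@continuous_comp _ _ _ -%R f).
    exact: opp_continuous.
  exact: fc.
split=> [t|t|t|t|||t|t|t|t|t]; try exact: is_derive1_opp_arg.
- exact: opc.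
- exact: opc.
- exact: det.
- by have := tan (- t); lra.
- by rewrite !sqrrN.
- by have := X3 (- t); lra.
- by have := X2 (- t); lra.
Qed.

Section Orbit.
Context {R : realType} {c : R} {p q r s p' q' r' s' : R -> R}.
Hypothesis H : null_orbit c p q r s p' q' r' s'.

Let n t := r t ^+ 2 + s t ^+ 2.
Let m t := 2 * (r t * r' t + s t * s' t).

(** From |w|^2 |w'|^2 = n'^2 / 4 + c^2 and |z|^2 |z'|^2 = n'^2 / 4, substituted
    into |w|^2 |z|^2 (|w'|^2 + |z'|^2) = |w|^2 |z|^2 c^2. *)
Lemma orbit_radial : radial c n m.
Proof.
have [pD qD rD sD r'c s'c det tan X1 X3 X2] := H.
split=> [t||t|t].
- apply: (is_derive_eq (is_derive1_add (is_derive1_sqr (rD t))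
    (is_derive1_sqr (sD t)))).
  by rewrite /m mulrDr.
- move=> t; apply: cvgMr; apply: cvgD; apply: cvgM.
  + exact: (is_derive1_continuous rD).
  + exact: r'c.
  + exact: (is_derive1_continuous sD).
  + exact: s'c.
- by rewrite addr_ge0 ?sqr_ge0.
- have wE : (p t ^+ 2 + q t ^+ 2) * (p' t ^+ 2 + q' t ^+ 2) =
      (p t * p' t + q t * q' t) ^+ 2 + (p t * q' t - q t * p' t) ^+ 2 by ring.
  have zE : (r t ^+ 2 + s t ^+ 2) * (r' t ^+ 2 + s' t ^+ 2) =
      (r t * r' t + s t * s' t) ^+ 2 + (r t * s' t - s t * r' t) ^+ 2 by ring.
  move: wE zE; rewrite (X3 t) (X2 t) (tan t) (det t) -/(n t).
  have -> : r t * r' t + s t * s' t = m t / 2 by rewrite /m; field.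
  have := X1 t; move: (p' t ^+ 2 + q' t ^+ 2) (r' t ^+ 2 + s' t ^+ 2) => a b.
  move=> abE wE zE.
  have : n t * ((1 + n t) * a) + (1 + n t) * (n t * b) =
      n t * (1 + n t) * c ^+ 2.
    by rewrite -abE; ring.
  by rewrite wE zE; lra.
Qed.

Lemma orbit_z'_le t : 0 < n t -> r' t ^+ 2 + s' t ^+ 2 <= c ^+ 2 * n t.
Proof.
move=> nt.
have zE : n t * (r' t ^+ 2 + s' t ^+ 2) =
    (m t / 2) ^+ 2 + (r t * s' t - s t * r' t) ^+ 2 by rewrite /n /m; field.
rewrite -(ler_pM2l nt) zE (orbit_X2 H).
have := radial_eq orbit_radial t; have := sqr_ge0 (m t).
by nra.
Qed.

(** The bound |w' - i c w|^2 <= 2 c^2 n^2, where the left-hand side is also the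
    squared speed of the rotating vector v = w exp(- i c t). *)
Lemma orbit_rot_le t :
  (p' t + c * q t) ^+ 2 + (q' t - c * p t) ^+ 2 <= 2 * c ^+ 2 * n t ^+ 2.
Proof.
have wE : (p t ^+ 2 + q t ^+ 2) *
    ((p' t + c * q t) ^+ 2 + (q' t - c * p t) ^+ 2) =
    (p t * p' t + q t * q' t) ^+ 2 +
    (p t * q' t - q t * p' t - c * (p t ^+ 2 + q t ^+ 2)) ^+ 2 by ring.
move: wE; rewrite (orbit_tan H) (orbit_X3 H) (orbit_det H) -/(n t).
have -> : r t * r' t + s t * s' t = m t / 2 by rewrite /m; field.
have := sqr_ge0 (p' t + c * q t); have := sqr_ge0 (q' t - c * p t).
move: (_ ^+ 2) (_ ^+ 2) => a b a0 b0 wE.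
have := radial_eq orbit_radial t; have := sqr_ge0 (m t).
by have := radial_ge0 orbit_radial t; nra.
Qed.

Hypothesis m0 : m 0 < 0.
Let mlt := radial_deriv_lt0 orbit_radial m0.
Let n_gt0 := radial_gt0 orbit_radial mlt.
Let K := 1 + 2 * n 0.

(** The two components of v = w exp(- i c t) converge, with error O(n). *)
Lemma orbit_rotating_limit : exists l1 l2 : R, forall t, 0 <= t ->
  `|p t * cos (c * t) + q t * sin (c * t) - l1| <= K * n t /\
  `|q t * cos (c * t) - p t * sin (c * t) - l2| <= K * n t.
Proof.
have [pD qD rD sD _ _ _ _ _ _ _] := H.
have K0 : 0 < K by rewrite /K; have := n_gt0 0; lra.
have cD t : is_derive t (1 : R) (fun t => cos (c * t)) (- (c * sin (c * t))).
  have := is_derive_cos_lin c 0 t; rewrite addr0.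
  by under eq_fun do rewrite addr0.
have sD' t : is_derive t (1 : R) (fun t => sin (c * t)) (c * cos (c * t)).
  have := is_derive_sin_lin c 0 t; rewrite addr0.
  by under eq_fun do rewrite addr0.
have v1D t :
  is_derive t (1 : R) (fun t => p t * cos (c * t) + q t * sin (c * t))
    ((p' t + c * q t) * cos (c * t) + (q' t - c * p t) * sin (c * t)).
  apply: (is_derive_eq (is_derive1_add (is_derive1_mul (pD t) (cD t))
      (is_derive1_mul (qD t) (sD' t)))).
  by ring.
have v2D t :
  is_derive t (1 : R) (fun t => q t * cos (c * t) - p t * sin (c * t))
    ((q' t - c * p t) * cos (c * t) - (p' t + c * q t) * sin (c * t)).
  apply: (is_derive_eq (is_derive1_sub (is_derive1_mul (qD t) (cD t))
      (is_derive1_mul (pD t) (sD' t)))).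
  by ring.
have gD t : is_derive t (1 : R) (fun t => K * n t) (K * m t).
  exact: (is_derive1_scale (radial_derive orbit_radial t) K).
have Kn0 t : 0 <= K * n t by rewrite mulr_ge0 ?ltW ?n_gt0.
have slow t : 0 <= t -> 2 * `|c| * n t <= - (K * m t).
  move=> /(radial_rate0 orbit_radial mlt); rewrite -/K.
  rewrite -(ler_pM2l K0).
  have -> : K * (- (2 * (`|c| / K)) * n t) = - (2 * `|c| * n t).
    by field; rewrite gt_eqF.
  lra.
have bound (x y t : R) :
    x ^+ 2 + y ^+ 2 <= 2 * c ^+ 2 * n t ^+ 2 -> 0 <= t -> `|x| <= - (K * m t).
  move=> xy t0; apply: le_trans (slow t t0).
  rewrite -(@ler_pXn2r _ 2)// ?nnegrE ?mulr_ge0 ?(ltW (n_gt0 _))//.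
  rewrite !exprMn !real_normK ?num_real//.
  have := sqr_ge0 y; have := mulr_ge0 (sqr_ge0 c) (sqr_ge0 (n t)); lra.
have rot t :
    ((p' t + c * q t) * cos (c * t) + (q' t - c * p t) * sin (c * t)) ^+ 2 +
    ((q' t - c * p t) * cos (c * t) - (p' t + c * q t) * sin (c * t)) ^+ 2 <=
    2 * c ^+ 2 * n t ^+ 2.
  apply: le_trans (orbit_rot_le t).
  rewrite -[leRHS]mul1r -(cos2Dsin2 (c * t)).
  by rewrite le_eqVlt; apply/orP; left; apply/eqP; ring.
have [l1 Hl1] := limit_of_dominated v1D gD
  (fun t => bound _ _ _ (rot t)) Kn0.
have rot' t :
    ((q' t - c * p t) * cos (c * t) - (p' t + c * q t) * sin (c * t)) ^+ 2 +
    ((p' t + c * q t) * cos (c * t) + (q' t - c * p t) * sin (c * t)) ^+ 2 <=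
    2 * c ^+ 2 * n t ^+ 2 by rewrite addrC.
have [l2 Hl2] := limit_of_dominated v2D gD
  (fun t => bound _ _ _ (rot' t)) Kn0.
by exists l1, l2 => t t0; split; [exact: Hl1|exact: Hl2].
Qed.

Let n_le (t : R) : 0 <= t -> n t <= n 0.
Proof.
apply: (@nonincreasing_after R n m 0 (radial_derive orbit_radial)) => // x _.
exact/ltW/mlt.
Qed.

Lemma orbit_phase : c != 0 -> exists theta : R, forall t, 0 <= t ->
  (p t - cos (c * t + theta)) ^+ 2 + (q t - sin (c * t + theta)) ^+ 2 <=
  2 * (K * n t) ^+ 2.
Proof.
move=> c0; have [l1 [l2 Hl]] := orbit_rotating_limit.
have K0 : 0 < K by rewrite /K; have := n_gt0 0; lra.
have vE t : (p t * cos (c * t) + q t * sin (c * t)) ^+ 2 +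
    (q t * cos (c * t) - p t * sin (c * t)) ^+ 2 = 1 + n t.
  by rewrite -(orbit_det H) -[RHS]mul1r -(cos2Dsin2 (c * t)); ring.
have l_unit : l1 ^+ 2 + l2 ^+ 2 = 1.
  pose M := 1 + 2 * K * (K * n 0 + `|l1| + `|l2|).
  have M0 : 0 < M.
    have n00 := ltW (n_gt0 0).
    by rewrite ltr_wpDr// !mulr_ge0 ?addr_ge0 ?mulr_ge0 ?(ltW K0).
  have near_unit t : 0 <= t -> `|l1 ^+ 2 + l2 ^+ 2 - 1| <= M * n t.
    move=> t0; have [h1 h2] := Hl t t0; have := vE t; move: h1 h2.
    move: (p t * _ + _) (q t * _ - _) => v1 v2 h1 h2 E.
    (* l^2 = v^2 - (v - l) (v + l) for each component *)
    have -> : l1 ^+ 2 + l2 ^+ 2 - 1 = n t - (v1 - l1) * (v1 - l1 + 2 * l1) -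
        (v2 - l2) * (v2 - l2 + 2 * l2).
      have -> : n t = v1 ^+ 2 + v2 ^+ 2 - 1 by rewrite E addrC addKr.
      by ring.
    have Kn : K * n t <= K * n 0 by rewrite ler_wpM2l ?n_le// ltW.
    have sq (d l : R) : `|d| <= K * n t ->
        `|d * (d + 2 * l)| <= K * n t * (K * n 0 + 2 * `|l|).
      move=> dl; rewrite normrM ler_pM//.
      apply: le_trans (ler_normD _ _) _; rewrite normrM ger0_norm//.
      by rewrite lerD2r (le_trans dl).
    apply: le_trans (ler_normB _ _) _.
    apply: le_trans (lerD (ler_normB _ _) (lexx _)) _.
    rewrite ger0_norm ?(ltW (n_gt0 _))//.
    apply: le_trans (lerD (lerD (lexx _) (sq _ _ h1)) (sq _ _ h2)) _.
    by rewrite le_eqVlt; apply/orP; left; apply/eqP; rewrite /M; ring.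
  (* n gets below the defect divided by M, which near_unit forbids *)
  apply/eqP; rewrite -subr_eq0 -normr_eq0 eq_le normr_ge0 andbT leNgt.
  apply/negP => D0.
  have [T T0 HT] := radial_small orbit_radial mlt c0 (divr_gt0 D0 M0).
  have T1 : T < T + 1 by rewrite ltrDl.
  have := near_unit (T + 1) (ltW (lt_trans T0 T1)).
  by have := HT (T + 1) T1; rewrite ltr_pdivlMr//; lra.
have [theta [ct st]] := unit_circle_angle l_unit.
exists theta => t t0; have [h1 h2] := Hl t t0.
rewrite cosD sinD ct st.
have sq (x : R) : `|x| <= K * n t -> x ^+ 2 <= (K * n t) ^+ 2.
  move=> xK; rewrite -(real_normK (num_real x)) lerXn2r ?nnegrE//.
  exact: le_trans xK.
have := lerD (sq _ h1) (sq _ h2); have := cos2Dsin2 (c * t).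
move: (cos _) (sin _) => C S CS; rewrite -mulr2n -[leRHS]mulr_natl.
apply: le_trans; rewrite le_eqVlt; apply/orP; left; apply/eqP.
(* rotations preserve distances; C^2 + S^2 = 1 removes the last term *)
transitivity ((p t * C + q t * S - l1) ^+ 2 + (q t * C - p t * S - l2) ^+ 2 +
  (1 - (C ^+ 2 + S ^+ 2)) * (p t ^+ 2 + q t ^+ 2 - l1 ^+ 2 - l2 ^+ 2)).
  by ring.
by rewrite CS subrr mul0r addr0.
Qed.

(** The left-hand sides are the squared Frobenius norms of A - U(c t + theta)
    and of its derivative, in coordinates. *)
Lemma orbit_asymptotics (mu : R) : mu < `|c| -> exists T theta : R, 0 < T /\
  forall t, T < t ->
  2 * ((p t - cos (c * t + theta)) ^+ 2 + (q t - sin (c * t + theta)) ^+ 2 +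
       (r t ^+ 2 + s t ^+ 2)) < expR (- mu * t) ^+ 2 /\
  2 * ((p' t + c * sin (c * t + theta)) ^+ 2 +
       (q' t - c * cos (c * t + theta)) ^+ 2 +
       (r' t ^+ 2 + s' t ^+ 2)) < expR (- mu * t) ^+ 2.
Proof.
move=> muc.
have c0 : c != 0.
  apply/eqP => c0; have := radial_le orbit_radial 0.
  by rewrite c0 normr0 mulr0 mul0r normr_le0 lt_eqF.
have [k [k0 kmu kc]] : exists k, [/\ 0 < k, mu < k & k < `|c|].
  have [mu0|mu0] := leP mu 0.
    by exists (`|c| / 2); split=> //; have := normr_gt0 c; rewrite c0; lra.
  by exists ((mu + `|c|) / 2); split; lra.
have [N [T1 [N0 T10 HN]]] := radial_decay orbit_radial mlt k0 kc.
have [theta Hth] := orbit_phase c0.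
(* M n bounds both squared norms on the half-line t >= 0, where n <= n 0 *)
pose M := 2 * (1 + c ^+ 2) * (4 * n 0 + 4 * K ^+ 2 * n 0 + 1).
have nn0 := n_gt0 0; have cc := sqr_ge0 c; have KK := sqr_ge0 K.
have n00 := ltW nn0.
have M0 : 0 <= M.
  by apply: mulr_ge0; [lra|have := mulr_ge0 KK n00; lra].
have MN0 : 0 <= M * N by rewrite mulr_ge0// ltW.
have k2 : 2 * mu < 2 * k by rewrite ltr_pM2l.
have [T2 T20 HT2] := expR_eventually_lt MN0 k2.
exists (T1 + T2), theta; split; first by rewrite addr_gt0.
move=> t Tt; have t0 : 0 <= t by lra.
have nt : M * n t < expR (- mu * t) ^+ 2.
  rewrite -expRM_natl; have -> : 2%:R * (- mu * t) = - (2 * mu) * t by ring.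
  apply: le_lt_trans (HT2 t _); last by lra.
  by rewrite -mulrA ler_wpM2l// HN//; lra.
have nt0 := n_gt0 t.
have n2 : n t ^+ 2 <= n 0 * n t by rewrite expr2 ler_pM2r// n_le.
have := Hth t t0.
have := orbit_rot_le t; have := orbit_z'_le nt0.
rewrite -/(n t).
set d := (p t - _) ^+ 2 + _; set z' := r' t ^+ 2 + _ => z'le gle dle.
have dle' : d <= 2 * K ^+ 2 * n 0 * n t.
  by apply: le_trans dle _; rewrite exprMn; have := ler_wpM2l KK n2; lra.
have gle' := le_trans gle (ler_wpM2l (mulr_ge0 (ler0n _ 2) cc) n2).
have ME : M * n t = 8 * (n 0 * n t) + 8 * (K ^+ 2 * n 0 * n t) + 2 * n t +
   8 * (c ^+ 2 * (n 0 * n t)) + 8 * (c ^+ 2 * (K ^+ 2 * n 0 * n t)) +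
   2 * (c ^+ 2 * n t).
  by rewrite /M; ring.
have nn : 0 <= n 0 * n t by rewrite mulr_ge0 ?ltW.
have Knn : 0 <= K ^+ 2 * n 0 * n t by rewrite -mulrA mulr_ge0.
have cnn := mulr_ge0 cc nn; have cKnn := mulr_ge0 cc Knn.
have cn := mulr_ge0 cc (ltW nt0).
split; apply: le_lt_trans nt; rewrite ME; first by lra.
(* p' + c sin = (p' + c q) - c (q - sin),
   q' - c cos = (q' - c p) + c (p - cos) *)
have split_le : (p' t + c * sin (c * t + theta)) ^+ 2 +
    (q' t - c * cos (c * t + theta)) ^+ 2 <=
    2 * ((p' t + c * q t) ^+ 2 + (q' t - c * p t) ^+ 2) + 2 * (c ^+ 2 * d).
  rewrite /d; move: (cos _) (sin _) => C S.
  have := sqr_ge0 (p' t + c * q t + c * (q t - S)).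
  have := sqr_ge0 (q' t - c * p t - c * (p t - C)).
  lra.
have := ler_wpM2l cc dle'; lra.
Qed.

End Orbit.

Lemma orbit_asymptoticsV {R : realType} (c : R) (p q r s p' q' r' s' : R -> R) :
  null_orbit c p q r s p' q' r' s' -> 0 < r 0 * r' 0 + s 0 * s' 0 ->
  forall mu : R, mu < `|c| -> exists T theta : R, 0 < T /\
  forall t, t < - T ->
  2 * ((p t - cos (c * t + theta)) ^+ 2 + (q t - sin (c * t + theta)) ^+ 2 +
       (r t ^+ 2 + s t ^+ 2)) < expR (mu * t) ^+ 2 /\
  2 * ((p' t + c * sin (c * t + theta)) ^+ 2 +
       (q' t - c * cos (c * t + theta)) ^+ 2 +
       (r' t ^+ 2 + s' t ^+ 2)) < expR (mu * t) ^+ 2.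
Proof.
move=> H m0 mu muc.
have [||T [theta [T0 HT]]] := orbit_asymptotics (null_orbit_rev H) _ (mu := mu).
- by rewrite !oppr0; lra.
- by rewrite normrN.
exists T, theta; split=> // t tT; have := HT (- t).
rewrite ltrNr => /(_ tT); rewrite !mulrNN !opprK => -[h1 h2]; split=> //.
by apply: le_lt_trans h2; rewrite le_eqVlt; apply/orP; left; apply/eqP; ring.
Qed.

(** * Coordinates on 2x2 matrices *)

Section Coordinates.
Context {R : realType}.
Implicit Types A B : 'M[R]_2.

(** The coordinates of a matrix in the orthogonal basis I, Z, K = diag(1, -1),
    L = antidiag(1, 1). The span of I and Z consists of the multiples of the
    rotations U(theta). *)
Definition coI A : R := 2^-1 * (A 0 0 + A 1 1).
Definition coZ A : R := 2^-1 * (A 1 0 - A 0 1).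
Definition coK A : R := 2^-1 * (A 0 0 - A 1 1).
Definition coL A : R := 2^-1 * (A 0 1 + A 1 0).

Let sum2 (f : 'I_2 -> R) : \sum_i f i = f 0 + f 1.
Proof. by rewrite big_ord_recl big_ord1; congr (_ + f _); apply: val_inj. Qed.

Lemma mxdotE A B :
  mxdot A B =
  2 * (coI A * coI B + coZ A * coZ B + coK A * coK B + coL A * coL B).
Proof.
rewrite /mxdot /mxtrace sum2 !mxE !sum2 !mxE /coI /coZ /coK /coL.
by field.
Qed.

Lemma detE A : \det A = coI A ^+ 2 + coZ A ^+ 2 - coK A ^+ 2 - coL A ^+ 2.
Proof.
rewrite (expand_det_row _ 0) sum2 /cofactor !det_mx11 !mxE /=.
have -> : lift 0 0 = 1 :> 'I_2 by apply: val_inj.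
have -> : lift 1 0 = 0 :> 'I_2 by apply: val_inj.
rewrite /coI /coZ /coK /coL /=; by field.
Qed.

Lemma cofE A : (coI (cof A) = coI A) * (coZ (cof A) = coZ A) *
  (coK (cof A) = - coK A) * (coL (cof A) = - coL A).
Proof.
by rewrite /cof /coI /coZ /coK /coL; do !split; rewrite !(mxE, sum2) /=; ring.
Qed.

Lemma X1E A B : X1 A B = coI B ^+ 2 + coZ B ^+ 2 + (coK B ^+ 2 + coL B ^+ 2).
Proof.
rewrite /X1 /mxnorm sqr_sqrtr mxdotE.
  by field.
by rewrite -!expr2 mulr_ge0 ?addr_ge0 ?sqr_ge0.
Qed.

Lemma X2E A B : X2 A B = 2 * (coK A * coL B - coL A * coK B).
Proof.
rewrite /X2 mxdotE /coI /coZ /coK /coL !(mxE, sum2) /=; by field.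
Qed.

Lemma X3E A B : X3 A B = 2 * (coI A * coZ B - coZ A * coI B).
Proof.
rewrite /X3 mxdotE /coI /coZ /coK /coL !(mxE, sum2) /=; by field.
Qed.

Lemma mxnorm_lt A (e : R) : 0 < e ->
  2 * (coI A ^+ 2 + coZ A ^+ 2 + (coK A ^+ 2 + coL A ^+ 2)) < e ^+ 2 ->
  mxnorm A < e.
Proof.
move=> e0 Ae; rewrite -(@ltr_pXn2r _ 2)// ?nnegrE ?sqrtr_ge0 ?(ltW e0)//.
apply: le_lt_trans Ae; have := X1E A A; rewrite /X1; lra.
Qed.

Lemma conformalE (a b : R) (M := a *: 1%:M + b *: @Z R) :
  (coI M = a) * (coZ M = b) * (coK M = 0) * (coL M = 0).
Proof.
by rewrite /M /coI /coZ /coK /coL; do !split; rewrite !mxE /=; field.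
Qed.

Lemma coordB A B :
  (coI (A - B) = coI A - coI B) * (coZ (A - B) = coZ A - coZ B) *
  (coK (A - B) = coK A - coK B) * (coL (A - B) = coL A - coL B).
Proof.
by rewrite /coI /coZ /coK /coL; do !split; rewrite !mxE; ring.
Qed.

Lemma coordZ (k : R) A :
  (coI (k *: A) = k * coI A) * (coZ (k *: A) = k * coZ A) *
  (coK (k *: A) = k * coK A) * (coL (k *: A) = k * coL A).
Proof.
by rewrite /coI /coZ /coK /coL; do !split; rewrite !mxE; ring.
Qed.

Lemma is_derive_entry (M : R -> 'M[R]_2) t (i j : 'I_2) :
  derivable M t 1 -> is_derive t (1 : R) (fun x => M x i j) (derive1 M t i j).
Proof.
move=> dM; rewrite derive1E derive_mx// mxE; apply: derivableP.
exact: ((derivable_mxP _ _ _).1 dM).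
Qed.

Lemma derive1_entries (M : R -> 'M[R]_2) t (D : 'M[R]_2) :
  (forall i j, is_derive t (1 : R) (fun x => M x i j) (D i j)) ->
  derive1 M t = D.
Proof.
move=> MD; have dM : derivable M t 1.
  by apply/derivable_mxP => i j; case: (MD i j).
rewrite derive1E derive_mx//; apply/matrixP => i j.
by rewrite mxE; case: (MD i j).
Qed.

Lemma is_derive_coord (M : R -> 'M[R]_2) t : derivable M t 1 ->
  [/\ is_derive t (1 : R) (fun x => coI (M x)) (coI (derive1 M t)),
      is_derive t (1 : R) (fun x => coZ (M x)) (coZ (derive1 M t)),
      is_derive t (1 : R) (fun x => coK (M x)) (coK (derive1 M t)) &
      is_derive t (1 : R) (fun x => coL (M x)) (coL (derive1 M t))].
Proof.
move=> /is_derive_entry dM; split.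
- exact: (is_derive1_scale (is_derive1_add (dM 0 0) (dM 1 1)) _).
- exact: (is_derive1_scale (is_derive1_sub (dM 1 0) (dM 0 1)) _).
- exact: (is_derive1_scale (is_derive1_sub (dM 0 0) (dM 1 1)) _).
- exact: (is_derive1_scale (is_derive1_add (dM 0 1) (dM 1 0)) _).
Qed.

Lemma derive_sub_rotation (A : R -> 'M[R]_2) (c theta t : R) :
  derivable A t 1 ->
  derive1 (fun x => A x - U (c * x + theta)) t =
  derive1 A t - (- (c * sin (c * t + theta)) *: 1%:M +
                 (c * cos (c * t + theta)) *: @Z R).
Proof.
move=> dA; apply: derive1_entries => i j.
have entry (B : 'M[R]_2) (a b : R) : (B - (a *: 1%:M + b *: @Z R)) i j =
    B i j - (a * (1%:M : 'M[R]_2) i j + b * @Z R i j) by rewrite !mxE.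
rewrite entry; under eq_fun do rewrite /U entry.
apply: is_derive1_sub; first exact: is_derive_entry.
have constM (f : R -> R) (df k : R) : is_derive t (1 : R) f df ->
    is_derive t (1 : R) (fun x => f x * k) (df * k).
  move=> fD; apply: (is_derive_eq (is_derive1_mul fD (is_derive_cst k t 1))).
  by rewrite mulr0 addr0.
exact: (is_derive1_add (constM _ _ _ (is_derive_cos_lin c theta t))
  (constM _ _ _ (is_derive_sin_lin c theta t))).
Qed.

End Coordinates.

(** * Solutions of the matrix equation *)

(** The coordinate functions of A, with those of its derivative, form a null
    orbit. *)
Definition null_motion {R : realType} (c : R) (A : R -> 'M[R]_2) : Prop :=
  null_orbit c (coI \o A) (coZ \o A) (coK \o A) (coL \o A)
    (coI \o derive1 A) (coZ \o derive1 A) (coK \o derive1 A) (coL \o derive1 A).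

(** Conservation of X1, X2 and X3, and tangency of the velocity to SL(2, R),
    which comes from differentiating det A = 1. *)
Lemma solution_null_motion {R : realType} (A : R -> 'M[R]_2) (c : R) :
  solution A -> X1 (A 0) (derive1 A 0) = c ^+ 2 ->
  X3 (A 0) (derive1 A 0) = 2 * c -> X2 (A 0) (derive1 A 0) = 0 ->
  null_motion c A.
Proof.
have aux (a b d e : R) : 0 = 2 * a + 2 * b - (2 * d + 2 * e) -> a + b = d + e.
  by lra.
have aux' (l a b d e a' b' d' e' : R) : a * a' + b * b' = d * d' + e * e' ->
    2 * (a' * (l * a)) + 2 * (b' * (l * b)) +
    (2 * (d' * - (l * d)) + 2 * (e' * - (l * e))) = 0.
  move=> E; transitivity (2 * l * ((a * a' + b * b') - (d * d' + e * e'))).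
    by ring.
  by rewrite E subrr mulr0.
move=> [_ detA [dA ddA _] [lam _ lamE]]; rewrite X1E X2E X3E => h1 h3 h2.
have D1 t := is_derive_coord (dA t).
have D2 t := is_derive_coord (ddA t).
have {}D2 t : [/\
    is_derive t (1 : R) (coI \o derive1 A) (lam t * coI (A t)),
    is_derive t (1 : R) (coZ \o derive1 A) (lam t * coZ (A t)),
    is_derive t (1 : R) (coK \o derive1 A) (- (lam t * coK (A t))) &
    is_derive t (1 : R) (coL \o derive1 A) (- (lam t * coL (A t)))].
  have := D2 t; have -> : derive1 (derive1 A) t = lam t *: cof (A t) := lamE t.
  by rewrite !coordZ !cofE !mulrN.
have det t : coI (A t) ^+ 2 + coZ (A t) ^+ 2 =
    1 + (coK (A t) ^+ 2 + coL (A t) ^+ 2).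
  by have := detA t; rewrite /SL2/= detE; lra.
have tan t : coI (A t) * coI (derive1 A t) + coZ (A t) * coZ (derive1 A t) =
    coK (A t) * coK (derive1 A t) + coL (A t) * coL (derive1 A t).
  have [pD qD rD sD] := D1 t.
  have E := is_derive1_sub
    (is_derive1_add (is_derive1_sqr pD) (is_derive1_sqr qD))
    (is_derive1_add (is_derive1_sqr rD) (is_derive1_sqr sD)).
  have [_] := E; rewrite (_ : (fun _ => _) = cst 1); last first.
    by apply/funext => x /=; rewrite det addrK.
  by rewrite derive_cst => /aux.
have const (f df : R -> R) : (forall t, is_derive t (1 : R) f (df t)) ->
    (forall t, df t = 0) -> forall t, f t = f 0.
  move=> fD df0 t; apply: is_derive_0_is_cst => x.
  by have := fD x; rewrite df0.
split=> [t|t|t|t||||t|t|t|t].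
- by case: (D1 t).
- by case: (D1 t).
- by case: (D1 t).
- by case: (D1 t).
- apply: (@is_derive1_continuous _ _ (fun t => - (lam t * coK (A t)))) => t.
  by have [] := D2 t.
- apply: (@is_derive1_continuous _ _ (fun t => - (lam t * coL (A t)))) => t.
  by have [] := D2 t.
- exact: det.
- exact: tan.
- rewrite -h1.
  pose f x := coI (derive1 A x) ^+ 2 + coZ (derive1 A x) ^+ 2 +
    (coK (derive1 A x) ^+ 2 + coL (derive1 A x) ^+ 2).
  suff: forall t, f t = f 0 by apply.
  apply: const => {}t.
    have [pD qD rD sD] := D2 t.
    exact: (is_derive1_add
      (is_derive1_add (is_derive1_sqr pD) (is_derive1_sqr qD))
      (is_derive1_add (is_derive1_sqr rD) (is_derive1_sqr sD))).
  exact: aux' (tan t).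
- have -> : c = coI (A 0) * coZ (derive1 A 0) -
      coZ (A 0) * coI (derive1 A 0) by lra.
  pose f x := coI (A x) * coZ (derive1 A x) - coZ (A x) * coI (derive1 A x).
  suff: forall t, f t = f 0 by apply.
  apply: const => {}t.
    have [pD qD _ _] := D1 t; have [pD' qD' _ _] := D2 t.
    exact: (is_derive1_sub (is_derive1_mul pD qD') (is_derive1_mul qD pD')).
  by rewrite /=; ring.
- have -> : 0 = coK (A 0) * coL (derive1 A 0) -
      coL (A 0) * coK (derive1 A 0) :> R by lra.
  pose f x := coK (A x) * coL (derive1 A x) - coL (A x) * coK (derive1 A x).
  suff: forall t, f t = f 0 by apply.
  apply: const => {}t.
    have [_ _ rD sD] := D1 t; have [_ _ rD' sD'] := D2 t.
    exact: (is_derive1_sub (is_derive1_mul rD sD') (is_derive1_mul sD rD')).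
  by rewrite /=; ring.
Qed.

Section NullOrbits.
Context {R : realType}.

Lemma null_motion_mxdot (A : R -> 'M[R]_2) (c t : R) :
  null_motion c A ->
  mxdot (A t) (derive1 A t) =
  2 * (2 * (coK (A t) * coK (derive1 A t) + coL (A t) * coL (derive1 A t))).
Proof. by move=> H; have /= := orbit_tan H t; rewrite mxdotE; lra. Qed.

Lemma null_motion_TSL2 (A : R -> 'M[R]_2) (c t : R) :
  null_motion c A ->
  [/\ TSL2 (A t, derive1 A t), X1 (A t) (derive1 A t) = c ^+ 2,
    X3 (A t) (derive1 A t) = 2 * c & X2 (A t) (derive1 A t) = 0].
Proof.
move=> H; rewrite X1E X2E X3E.
have /= h1 := orbit_X1 H t; have /= h2 := orbit_X2 H t.
have /= h3 := orbit_X3 H t; have /= h4 := orbit_det H t.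
have /= h5 := orbit_tan H t.
split; [split => /=| | |]; rewrite ?h2 ?h3 ?mulr0//.
- by rewrite detE; lra.
- by rewrite mxdotE !cofE; lra.
Qed.

Lemma solution_invariant_Ws (c : R) : invariant_flow (Ws (c ^+ 2) (2 * c)).
Proof.
move=> A solA [_ /= [h1 h3 h2 neg]] t.
have H := solution_null_motion solA h1 h3 h2.
have [T e1 e3 e2] := null_motion_TSL2 t H.
split; first exact: T.
split; [exact: e1|exact: e3|exact: e2|rewrite /=].
move: neg; rewrite !(null_motion_mxdot _ H) => neg.
rewrite pmulr_rlt0//; apply: (radial_deriv_lt0 (orbit_radial H)).
by move: neg; rewrite pmulr_rlt0.
Qed.

Lemma solution_invariant_Wu (c : R) : invariant_flow (Wu (c ^+ 2) (2 * c)).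
Proof.
move=> A solA [_ /= [h1 h3 h2 neg]] t.
have H := solution_null_motion solA h1 h3 h2.
have [T e1 e3 e2] := null_motion_TSL2 t H.
split; first exact: T.
split; [exact: e1|exact: e3|exact: e2|rewrite /=].
move: neg; rewrite !(null_motion_mxdot _ H) => neg.
rewrite pmulr_rgt0//; apply: (radial_deriv_gt0 (orbit_radial H)).
by move: neg; rewrite pmulr_rgt0.
Qed.

(** The matrix p I + q Z + r K + s L. *)
Definition of_coords (p q r s : R) : 'M[R]_2 :=
  \matrix_(i < 2, j < 2)
    nth 0 (nth [::] [:: [:: p + r; s - q]; [:: q + s; p - r]] i) j.

Lemma of_coordsE (p q r s : R) (A := of_coords p q r s) :
  (coI A = p) * (coZ A = q) * (coK A = r) * (coL A = s).
Proof.
by rewrite /coI /coZ /coK /coL /A; do !split; rewrite !mxE /=; field.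
Qed.

(** Explicit initial data with n = 4, for which 1 + 2 n = 9 is a square, z = 2
    and w = sqrt 5 real; then n' = 8 d / 3, where d is either square root of
    c^2, and p', q', r' follow from w w' = n' / 2 + i c and z z' = n' / 2. *)
Lemma orbit_point (c d : R) : d ^+ 2 = c ^+ 2 ->
  let u := Num.sqrt 5 : R in
  let A := of_coords u 0 2 0 in
  let B := of_coords (4 * d / (3 * u)) (c / u) (2 * d / 3) 0 in
  [/\ TSL2 (A, B), X1 A B = c ^+ 2, X3 A B = 2 * c, X2 A B = 0 &
      mxdot A B = 16 / 3 * d].
Proof.
move=> dc /=.
have u0 : Num.sqrt (5 : R) != 0 by rewrite gt_eqF// sqrtr_gt0.
have u2 : Num.sqrt (5 : R) ^+ 2 = 5 by rewrite sqr_sqrtr.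
move: (Num.sqrt 5) u0 u2 => u u0 u2.
rewrite X1E X2E X3E mxdotE !of_coordsE; split.
- split => /=; first by rewrite detE !of_coordsE; lra.
  by rewrite mxdotE !cofE !of_coordsE; field.
- rewrite !expr_div_n !exprMn u2 dc; by field.
- by field.
- by ring.
- by field.
Qed.

End NullOrbits.

Lemma mxnorm_derive_lt {R : realType} (A : R -> 'M[R]_2) (c theta t e : R) :
  0 < e -> derivable A t 1 ->
  2 * ((coI (A t) - cos (c * t + theta)) ^+ 2 +
       (coZ (A t) - sin (c * t + theta)) ^+ 2 +
       (coK (A t) ^+ 2 + coL (A t) ^+ 2)) < e ^+ 2 /\
  2 * ((coI (derive1 A t) + c * sin (c * t + theta)) ^+ 2 +
       (coZ (derive1 A t) - c * cos (c * t + theta)) ^+ 2 +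
       (coK (derive1 A t) ^+ 2 + coL (derive1 A t) ^+ 2)) < e ^+ 2 ->
  forall j : nat, (j <= 1)%N ->
    mxnorm (derive1n j (fun s => A s - U (c * s + theta)) t) < e.
Proof.
move=> e0 dA [h0 h1] [|[|//]] _ /=; apply: mxnorm_lt => //.
- by rewrite /U !coordB !conformalE !subr0.
- by rewrite derive_sub_rotation// !coordB !conformalE !subr0 opprK.
Qed.

Theorem theorem12p2 (R : realType) (x1 x3 : R)
    (hx13 : x1 = 4^-1 * x3 ^+ 2) (hx1 : 0 < x1) :
  [/\ Ws x1 x3 !=set0, Wu x1 x3 !=set0,
      invariant_flow (Ws x1 x3) & invariant_flow (Wu x1 x3)] /\
  (forall mu : R, 0 < mu -> mu < 2^-1 * `|x3| ->
   forall A : R -> 'M[R]_2, solution A ->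
     (Ws x1 x3 (A 0, A^`() 0) ->
      exists T thetap : R, 0 < T /\
        forall (j : nat) (t : R), (j <= 1)%N -> T < t ->
          mxnorm (derive1n j (fun s : R => A s - U (2^-1 * x3 * s + thetap)) t)
            < expR (- mu * t)) /\
     (Wu x1 x3 (A 0, A^`() 0) ->
      exists T thetam : R, 0 < T /\
        forall (j : nat) (t : R), (j <= 1)%N -> t < - T ->
          mxnorm (derive1n j (fun s : R => A s - U (2^-1 * x3 * s + thetam)) t)
            < expR (mu * t))).
Proof.
pose c := 2^-1 * x3.
have x3E : x3 = 2 * c by rewrite /c; field.
have x1E : x1 = c ^+ 2 by rewrite hx13 /c; field.
have normc : 2^-1 * `|x3| = `|c| by rewrite /c normrM gtr0_norm.
have c0 : c != 0 by apply/eqP => c0; move: hx1; rewrite x1E c0 expr0n ltxx.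
rewrite normc -/c; clearbody c; rewrite {}x3E {}x1E in hx13 hx1 normc *.
clear hx13 normc.
have cpos : 0 < `|c| by rewrite normr_gt0.
have abs2 : `|c| ^+ 2 = c ^+ 2 by rewrite real_normK// num_real.
split; [split|].
- have dc : (- `|c|) ^+ 2 = c ^+ 2 by rewrite sqrrN.
  have [T e1 e3 e2 e] := orbit_point dc.
  eexists; split; first exact: T.
  by split; [exact: e1|exact: e3|exact: e2|rewrite e mulrN oppr_lt0 mulr_gt0].
- have [T e1 e3 e2 e] := orbit_point abs2.
  eexists; split; first exact: T.
  by split; [exact: e1|exact: e3|exact: e2|rewrite e mulr_gt0].
- exact: solution_invariant_Ws.
- exact: solution_invariant_Wu.
move=> mu _ muc A solA.
have [_ _ [dA _ _] _] := solA.
split=> -[_ /= [h1 h3 h2]]; have H := solution_null_motion solA h1 h3 h2;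
  rewrite (null_motion_mxdot _ H).
- rewrite pmulr_rlt0// => neg.
  have [T [theta [T0 HT]]] := orbit_asymptotics H neg muc.
  exists T, theta; split=> // j t j1 Tt.
  exact: mxnorm_derive_lt (expR_gt0 _) (dA t) (HT t Tt) j j1.
- rewrite !pmulr_rgt0// => pos.
  have [T [theta [T0 HT]]] := orbit_asymptoticsV H pos muc.
  exists T, theta; split=> // j t j1 Tt.
  exact: mxnorm_derive_lt (expR_gt0 _) (dA t) (HT t Tt) j j1.
Qed.
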